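(* Let $$\mathfrak{s}_{00}=\Big\{\mathbf{x}\in\ell_\infty:\sum_{\mathbf{x}(n)\neq0}\frac{1}{n}\text{ converges}\Big\}.$$ Then: (1) $\mathfrak{s}_{00}$ is an ideal in $\ell_\infty$. (2) $\mathfrak{s}_{00}$ is non-unital. (3) $\mathfrak{s}_{00}$ is isometrically isomorphic (as a normed algebra) to $C_{00}(Y)$ where $$Y=\bigcup\Big\{\mathrm{cl}_{\beta\mathbb{N}}A:A\subseteq\mathbb{N}\text{ and }\sum_{n\in A}\frac{1}{n}\text{ converges}\Big\}\subseteq\beta\mathbb{N}.$$ In particular, $Y$ is locally compact, non-compact, and contains $\mathbb{N}$ densely. (4) $\mathfrak{s}_{00}$ contains an isometric copy of the normed algebra $\bigoplus_{n=1}^\infty\ell_\infty$. (5) $\mathfrak{s}_{00}/c_{00}$ contains an isomorphic copy of the algebra $\bigoplus_{i<2^\omega}\ell_\infty/c_{00}$.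
   Context: $\mathbb{N}=\{1,2,\ldots\}$ carries the discrete topology, and $\beta\mathbb{N}$ is its Stone–Čech compactification. $\ell_\infty$ is the normed algebra of bounded complex sequences (pointwise operations, supremum norm), and $c_{00}$ is the ideal of sequences with only finitely many non-zero terms. $C_{00}(Y)$ is the normed algebra (supremum norm) of continuous bounded $f:Y\to\mathbb{C}$ whose support $\mathrm{cl}_Y\{y:f(y)\neq0\}$ is compact. An algebra is unital if it has a multiplicative identity. For a collection $\{X_i:i\in I\}$ of algebras, $\bigoplus_{i\in I}X_i$ is the algebra of all families $(x_i)_{i\in I}$ with $x_i\in X_i$ and $x_i=0$ for all but finitely many $i$, with componentwise operations; if the $X_i$ are normed, it carries the norm $\sup_{i\in I}\|x_i\|_{X_i}$. The index set $\{i<2^\omega\}$ has the cardinality of the continuum. ''Contains an isomorphic (isometric) copy'' means that there is a subalgebra which is algebra-isomorphic (isometrically algebra-isomorphic) to the given algebra. *)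

(* Defs.v *)
From HB Require Import structures.
From mathcomp Require Import all_boot all_order all_algebra.
From mathcomp Require Import all_classical all_reals all_analysis.
From mathcomp Require Import complex.

Set Implicit Arguments.
Unset Strict Implicit.
Unset Printing Implicit Defensive.

Import Order.TTheory GRing.Theory Num.Theory.
Import numFieldNormedType.Exports.
Import Normc.

Local Open Scope classical_set_scope.
Local Open Scope quotient_scope.
Local Open Scope ring_scope.

(* Associative algebras, not assumed to be unital: MathComp's own algebras     *)
(* all carry a 1.                                                              *)
HB.mixin Record Lmodule_isNuAlg (K : pzRingType) A of GRing.Lmodule K A := {
  nmul : A -> A -> A;
  nmulA : associative nmul;
  nmulDl : left_distributive nmul +%R;
  nmulDr : right_distributive nmul +%R;
  nscalerAl : forall (a : K) (x y : A), a *: nmul x y = nmul (a *: x) y;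
  nscalerAr : forall (a : K) (x y : A), a *: nmul x y = nmul x (a *: y)
}.

#[short(type="nuAlgType")]
HB.structure Definition NuAlg (K : pzRingType) :=
  {A of Lmodule_isNuAlg K A & GRing.Lmodule K A}.

(* A normed algebra is complex, but its norm is real-valued: this is not the   *)
(* R[i]-valued norm of a normedModType R[i].                                   *)
HB.mixin Record NuAlg_isNormed (R : realType) A of NuAlg R[i] A := {
  nnorm : A -> R;
  nnorm0_eq0 : forall x, nnorm x = 0 -> x = 0;
  ler_nnormD : forall x y, nnorm (x + y) <= nnorm x + nnorm y;
  nnormZ : forall (a : R[i]) x, nnorm (a *: x) = normc a * nnorm x;
  ler_nnormM : forall x y : A, nnorm (nmul x y) <= nnorm x * nnorm y
}.

#[short(type="normedNuAlgType")]
HB.structure Definition NormedNuAlg (R : realType) :=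
  {A of NuAlg_isNormed R A & NuAlg R[i] A}.

Section Subalgebras.
Context {K : pzRingType} (A : nuAlgType K).

Definition is_subalg (S : set A) :=
  [/\ S 0,
      forall x y, S x -> S y -> S (x + y),
      forall a x, S x -> S (a *: x) &
      forall x y, S x -> S y -> S (nmul x y)].

Definition is_ideal (I : set A) :=
  [/\ I 0,
      forall x y, I x -> I y -> I (x + y),
      forall a x, I x -> I (a *: x) &
      forall x y, I y -> I (nmul x y) /\ I (nmul y x)].

Record subalg := Subalg {
  subalg_set :> set A;
  subalg_closed : is_subalg subalg_set
}.

Record ideal := Ideal {
  ideal_set :> set A;
  ideal_closed : is_ideal ideal_set
}.

Lemma ideal_is_subalg (I : ideal) : is_subalg I.
Proof. by case: I => I [I0 ID IZ IM]; split=> // x y _ /(IM x)[]. Qed.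

Definition subalg_of_ideal (I : ideal) : subalg := Subalg (ideal_is_subalg I).

Definition unital := exists e : A, forall x, nmul e x = x /\ nmul x e = x.

End Subalgebras.

Section SubalgebraType.
Context {K : pzRingType} {A : nuAlgType K} (S : subalg A).

Definition subalg_pred : {pred A} := fun x => x \in (S : set A).

Lemma subalg_submod_closed : submod_closed subalg_pred.
Proof.
case: (subalg_closed S) => S0 SD SZ _; split=> [|a x y]; first exact/mem_set.
by move=> /set_mem Sx /set_mem Sy; apply/mem_set/SD => //; exact: SZ.
Qed.

HB.instance Definition _ :=
  GRing.isSubmodClosed.Build K A subalg_pred subalg_submod_closed.

Definition subalg_type := {x : A | x \in subalg_pred}.

HB.instance Definition _ := SubChoice.on subalg_type.
HB.instance Definition _ := [SubChoice_isSubLmodule of subalg_type by <:].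

Lemma subalg_mul_subproof (x y : subalg_type) :
  nmul (val x) (val y) \in subalg_pred.
Proof.
case: (subalg_closed S) => _ _ _ SM.
by apply/mem_set/SM; apply/set_mem; [exact: (valP x)|exact: (valP y)].
Qed.

Definition subalg_mul (x y : subalg_type) : subalg_type :=
  Sub (nmul (val x) (val y)) (subalg_mul_subproof x y).

Fact subalg_mulA : associative subalg_mul.
Proof. by move=> x y z; apply: val_inj; rewrite /= nmulA. Qed.
Fact subalg_mulDl : left_distributive subalg_mul +%R.
Proof. by move=> x y z; apply: val_inj; rewrite /= nmulDl. Qed.
Fact subalg_mulDr : right_distributive subalg_mul +%R.
Proof. by move=> x y z; apply: val_inj; rewrite /= nmulDr. Qed.
Fact subalg_scalerAl (a : K) (x y : subalg_type) :
  a *: subalg_mul x y = subalg_mul (a *: x) y.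
Proof. by apply: val_inj; rewrite /= nscalerAl. Qed.
Fact subalg_scalerAr (a : K) (x y : subalg_type) :
  a *: subalg_mul x y = subalg_mul x (a *: y).
Proof. by apply: val_inj; rewrite /= nscalerAr. Qed.

HB.instance Definition _ := Lmodule_isNuAlg.Build K subalg_type
  subalg_mulA subalg_mulDl subalg_mulDr subalg_scalerAl subalg_scalerAr.

End SubalgebraType.

Section NormedSubalgebraType.
Context {R : realType} {A : normedNuAlgType R} (S : subalg A).

Definition subalg_norm (x : subalg_type S) : R := nnorm (val x).

Fact subalg_norm0_eq0 (x : subalg_type S) : subalg_norm x = 0 -> x = 0.
Proof. by move=> /nnorm0_eq0 x0; apply: val_inj. Qed.
Fact subalg_normD (x y : subalg_type S) :
  subalg_norm (x + y) <= subalg_norm x + subalg_norm y.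
Proof. exact: ler_nnormD. Qed.
Fact subalg_normZ (a : R[i]) (x : subalg_type S) :
  subalg_norm (a *: x) = normc a * subalg_norm x.
Proof. exact: nnormZ. Qed.
Fact subalg_normM (x y : subalg_type S) :
  subalg_norm (nmul x y) <= subalg_norm x * subalg_norm y.
Proof. exact: ler_nnormM. Qed.

HB.instance Definition _ := NuAlg_isNormed.Build R (subalg_type S)
  subalg_norm0_eq0 subalg_normD subalg_normZ subalg_normM.

End NormedSubalgebraType.

Section Quotients.
Context {K : pzRingType} {A : nuAlgType K} (I : ideal A).

Definition ideal_pred : {pred A} := fun x => x \in (I : set A).

Lemma ideal_predP x : reflect (ideal_set I x) (x \in ideal_pred).
Proof. by apply: (iffP idP) => [/set_mem|/mem_set]. Qed.

Lemma ideal_zmod_closed : zmod_closed ideal_pred.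
Proof.
case: (ideal_closed I) => I0 ID IZ _; split=> [|x y]; first exact/ideal_predP.
move=> /ideal_predP Ix /ideal_predP Iy; apply/ideal_predP/ID => //.
by rewrite -scaleN1r; exact: IZ.
Qed.

HB.instance Definition _ :=
  GRing.isZmodClosed.Build A ideal_pred ideal_zmod_closed.

Definition quot_alg : Type := Quotient.quot ideal_pred.

HB.instance Definition _ := GRing.Zmodule.on quot_alg.
HB.instance Definition _ := EqQuotient.on quot_alg.

Definition quot_class (x : A) : quot_alg := \pi_quot_alg x.

Lemma quot_classP (x y : A) : quot_class x = quot_class y <-> ideal_set I (x - y).
Proof.
rewrite /quot_class; split=> [/eqP|Ixy]; last first.
  by apply/eqP; rewrite -Quotient.idealrBE; apply/ideal_predP.
by rewrite -Quotient.idealrBE => /ideal_predP.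
Qed.

Lemma quot_classD (x y : A) : quot_class (x + y) = quot_class x + quot_class y.
Proof. by rewrite /quot_class !piE. Qed.

Lemma quot_class_repr (u : quot_alg) : quot_class (repr u) = u.
Proof. exact: reprK. Qed.

Lemma quot_ind (P : quot_alg -> Prop) :
  (forall x, P (quot_class x)) -> forall u, P u.
Proof. by move=> Px u; rewrite -[u]quot_class_repr. Qed.

Definition quot_scale (a : K) (u : quot_alg) := quot_class (a *: repr u).
Definition quot_mul (u v : quot_alg) := quot_class (nmul (repr u) (repr v)).

Lemma quot_classZ a x : quot_class (a *: x) = quot_scale a (quot_class x).
Proof.
apply/quot_classP; rewrite -scalerBr; case: (ideal_closed I) => _ _ IZ _.
by apply/IZ/quot_classP; rewrite quot_class_repr.
Qed.

Lemma quot_classM x y :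
  quot_class (nmul x y) = quot_mul (quot_class x) (quot_class y).
Proof.
have nmulB (u v w : A) : nmul (u - v) w = nmul u w - nmul v w.
  by rewrite nmulDl -scaleN1r -nscalerAl scaleN1r.
have nmulBr (u v w : A) : nmul w (u - v) = nmul w u - nmul w v.
  by rewrite nmulDr -scaleN1r -nscalerAr scaleN1r.
apply/quot_classP; set x' := repr _; set y' := repr _.
have Ix : ideal_set I (x - x') by apply/quot_classP; rewrite quot_class_repr.
have Iy : ideal_set I (y - y') by apply/quot_classP; rewrite quot_class_repr.
case: (ideal_closed I) => _ ID _ IM.
have -> : nmul x y - nmul x' y' = nmul (x - x') y + nmul x' (y - y').
  by rewrite nmulB nmulBr addrA subrK.
by apply: ID; [exact: (IM y _ Ix).2|exact: (IM x' _ Iy).1].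
Qed.

Fact quot_scalerA a b u : quot_scale a (quot_scale b u) = quot_scale (a * b) u.
Proof. by elim/quot_ind: u => x; rewrite -!quot_classZ scalerA. Qed.
Fact quot_scale1r : left_id 1 quot_scale.
Proof. by elim/quot_ind => x; rewrite -!quot_classZ scale1r. Qed.
Fact quot_scalerDr : right_distributive quot_scale +%R.
Proof.
move=> a; elim/quot_ind => x; elim/quot_ind => y.
by rewrite -quot_classD -!quot_classZ -quot_classD scalerDr.
Qed.
Fact quot_scalerDl v : {morph quot_scale^~ v : a b / a + b}.
Proof.
by elim/quot_ind: v => x a b; rewrite -!quot_classZ -quot_classD scalerDl.
Qed.

HB.instance Definition _ := GRing.Zmodule_isLmodule.Build K quot_alg
  quot_scalerA quot_scale1r quot_scalerDr quot_scalerDl.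

Fact quot_mulA : associative quot_mul.
Proof.
elim/quot_ind => x; elim/quot_ind => y; elim/quot_ind => z.
by rewrite -!quot_classM nmulA.
Qed.
Fact quot_mulDl : left_distributive quot_mul +%R.
Proof.
elim/quot_ind => x; elim/quot_ind => y; elim/quot_ind => z.
by rewrite -quot_classD -!quot_classM -quot_classD nmulDl.
Qed.
Fact quot_mulDr : right_distributive quot_mul +%R.
Proof.
elim/quot_ind => x; elim/quot_ind => y; elim/quot_ind => z.
by rewrite -quot_classD -!quot_classM -quot_classD nmulDr.
Qed.
Fact quot_scalerAl (a : K) (u v : quot_alg) :
  a *: quot_mul u v = quot_mul (a *: u) v.
Proof.
elim/quot_ind: u => x; elim/quot_ind: v => y.
by rewrite /GRing.scale/= -!(quot_classM, quot_classZ) nscalerAl.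
Qed.
Fact quot_scalerAr (a : K) (u v : quot_alg) :
  a *: quot_mul u v = quot_mul u (a *: v).
Proof.
elim/quot_ind: u => x; elim/quot_ind: v => y.
by rewrite /GRing.scale/= -!(quot_classM, quot_classZ) nscalerAr.
Qed.

HB.instance Definition _ := Lmodule_isNuAlg.Build K quot_alg
  quot_mulA quot_mulDl quot_mulDr quot_scalerAl quot_scalerAr.

End Quotients.

Section IdealTrace.
Context {K : pzRingType} {A : nuAlgType K} (S : subalg A) (I : ideal A).

Lemma trace_is_ideal : is_ideal [set x : subalg_type S | ideal_set I (val x)].
Proof.
case: (ideal_closed I) => I0 ID IZ IM; split=> //=.
- by move=> x y; exact: ID.
- by move=> a x; exact: IZ.
- by move=> x y; exact: IM.
Qed.

(* The ideal I :&: S of the algebra S.                                         *)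
Definition ideal_trace : ideal (subalg_type S) := Ideal trace_is_ideal.

End IdealTrace.

Section Isomorphisms.

Definition alg_isomorphic {K : pzRingType} (A B : nuAlgType K) :=
  exists f : {linear A -> B}, bijective f /\ {morph f : x y / nmul x y}.

Definition alg_isometric {R : realType} (A B : normedNuAlgType R) :=
  exists f : {linear A -> B}, [/\ bijective f,
    {morph f : x y / nmul x y} & forall x, nnorm (f x) = nnorm x].

Definition contains_copy {K : pzRingType} (B A : nuAlgType K) :=
  exists S : subalg B, alg_isomorphic A (subalg_type S).

Definition contains_isometric_copy {R : realType} (B A : normedNuAlgType R) :=
  exists S : subalg B, alg_isometric A (subalg_type S).

End Isomorphisms.

Section SupNorm.
Context {R : realType} {T : Type}.
Implicit Types (f g : T -> R) (M c : R).

(* Since sup set0 = 0, this is the right supremum of norms when T is empty.    *)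
Definition fsup f : R := sup (range f).

Lemma le_fsup f t : has_ubound (range f) -> f t <= fsup f.
Proof. by move=> /ub_le_sup; apply; exists t. Qed.

Lemma fsup_le f M : 0 <= M -> (forall t, f t <= M) -> fsup f <= M.
Proof.
move=> M0 fM; have [r0|] := eqVneq (range f) set0; first by rewrite /fsup r0 sup0.
by move=> /set0P f0; apply: ge_sup => // _ [t _ <-].
Qed.

Lemma fsup_ge0 f : (forall t, 0 <= f t) -> 0 <= fsup f.
Proof.
move=> f0; have [fS|/sup_out] := pselect (has_sup (range f)); last first.
  by rewrite /fsup => ->.
have [[_ [t _ _]] fB] := fS.
exact: le_trans (f0 t) (le_fsup t fB).
Qed.

Lemma fsupZ f c : (forall t, 0 <= f t) -> has_ubound (range f) -> 0 <= c ->
  fsup (fun t => c * f t) = c * fsup f.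
Proof.
move=> f0 fB c0; apply/le_anti/andP; split.
  apply: fsup_le => [|t]; first by rewrite mulr_ge0// fsup_ge0.
  by rewrite ler_wpM2l// le_fsup.
have [->|cn0] := eqVneq c 0.
  by rewrite mul0r; apply: fsup_ge0 => t; rewrite mul0r.
have cp : 0 < c by rewrite lt_def cn0.
rewrite mulrC -ler_pdivlMr//; apply: fsup_le => [|t].
  by apply: divr_ge0 => //; apply: fsup_ge0 => t; rewrite mulr_ge0.
rewrite ler_pdivlMr// mulrC; apply: (@le_fsup (fun t => c * f t)).
case: fB => M MB; exists (c * M) => _ [u _ <-].
by rewrite ler_wpM2l// MB//; exists u.
Qed.

End SupNorm.

(* R[i] has no canonical topology; R[i]^o is R[i] with the topology given by   *)
(* the modulus.                                                                *)
Section BoundedFunctions.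
Context {R : realType} {T : Type}.
Implicit Types f g : T -> R[i]^o.

Definition fun_mul f g : T -> R[i]^o := fun t => f t * g t.

Fact fun_mulA : associative fun_mul.
Proof. by move=> f g h; apply/funext => t; exact: mulrA. Qed.
Fact fun_mulDl : left_distributive fun_mul +%R.
Proof. by move=> f g h; apply/funext => t; exact: mulrDl. Qed.
Fact fun_mulDr : right_distributive fun_mul +%R.
Proof. by move=> f g h; apply/funext => t; exact: mulrDr. Qed.
Fact fun_scalerAl (a : R[i]) f g : a *: fun_mul f g = fun_mul (a *: f) g.
Proof. by apply/funext => t; exact: mulrA. Qed.
Fact fun_scalerAr (a : R[i]) f g : a *: fun_mul f g = fun_mul f (a *: g).
Proof. by apply/funext => t; exact: mulrCA. Qed.

HB.instance Definition _ := Lmodule_isNuAlg.Build R[i] (T -> R[i]^o)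
  fun_mulA fun_mulDl fun_mulDr fun_scalerAl fun_scalerAr.

Definition bounded_function f := has_ubound (range (fun t => normc (f t))).

Lemma bounded_functionP f :
  bounded_function f <-> exists M, forall t, normc (f t) <= M.
Proof.
split=> [[M fM]|[M fM]]; exists M; last by move=> _ [t _ <-].
by move=> t; apply: fM; exists t.
Qed.

Lemma normc_ge0 (z : R[i]) : 0 <= normc z.
Proof. by case: z => a b; rewrite /normc sqrtr_ge0. Qed.

Lemma bounded_function_is_subalg : is_subalg bounded_function.
Proof.
split.
- by apply/bounded_functionP; exists 0 => t; rewrite normc0.
- move=> f g /bounded_functionP[M fM] /bounded_functionP[N gN].
  apply/bounded_functionP; exists (M + N) => t.
  exact: le_trans (le_normcD _ _) (lerD (fM t) (gN t)).
- move=> a f /bounded_functionP[M fM].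
  apply/bounded_functionP; exists (normc a * M) => t.
  by rewrite normcM ler_wpM2l// normc_ge0.
- move=> f g /bounded_functionP[M fM] /bounded_functionP[N gN].
  apply/bounded_functionP; exists (M * N) => t.
  by rewrite normcM ler_pM// normc_ge0.
Qed.

Definition bounded_subalg : subalg (T -> R[i]^o) :=
  Subalg bounded_function_is_subalg.

End BoundedFunctions.

Definition bfun (R : realType) (T : Type) : Type :=
  subalg_type (@bounded_subalg R T).

Section BfunNorm.
Context {R : realType} {T : Type}.
Implicit Types x y : bfun R T.

HB.instance Definition _ := NuAlg.on (bfun R T).

Definition bfun_fun x : T -> R[i]^o := val x.

Coercion bfun_fun : bfun >-> Funclass.

Lemma bfun0E t : (0 : bfun R T) t = 0. Proof. by []. Qed.
Lemma bfunDE x y t : (x + y : bfun R T) t = x t + y t. Proof. by []. Qed.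
Lemma bfunZE (a : R[i]) x t : (a *: x : bfun R T) t = a * x t.
Proof. by []. Qed.
Lemma bfunME x y t : (nmul x y : bfun R T) t = x t * y t. Proof. by []. Qed.

Definition bfun_norm x : R := fsup (fun t => normc (x t)).

Fact bfunB x : has_ubound (range (fun t => normc (x t))).
Proof. exact: set_mem (valP x). Qed.

Fact le_bfun_norm x t : normc (x t) <= bfun_norm x.
Proof. by apply: (@le_fsup _ _ (fun t => normc _)); exact: bfunB. Qed.

Fact bfun_norm_ge0 x : 0 <= bfun_norm x.
Proof. by apply: fsup_ge0 => t; exact: normc_ge0. Qed.

Fact bfun_norm0_eq0 x : bfun_norm x = 0 -> x = 0.
Proof.
move=> x0; apply/val_inj/funext => t; apply: eq0_normc.
by apply/le_anti; rewrite normc_ge0 andbT -x0; exact: le_bfun_norm.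
Qed.
Fact bfun_normD x y : bfun_norm (x + y) <= bfun_norm x + bfun_norm y.
Proof.
apply: fsup_le => [|t]; first by rewrite addr_ge0// bfun_norm_ge0.
exact: le_trans (le_normcD _ _) (lerD (le_bfun_norm _ _) (le_bfun_norm _ _)).
Qed.
Fact bfun_normZ (a : R[i]) x : bfun_norm (a *: x) = normc a * bfun_norm x.
Proof.
rewrite -(fsupZ _ (bfunB x) (normc_ge0 a)) => [|t]; last exact: normc_ge0.
by congr fsup; apply/funext => t; rewrite -normcM.
Qed.
Fact bfun_normM x y : bfun_norm (nmul x y) <= bfun_norm x * bfun_norm y.
Proof.
apply: fsup_le => [|t]; first by rewrite mulr_ge0// bfun_norm_ge0.
by rewrite normcM ler_pM ?normc_ge0 ?le_bfun_norm.
Qed.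

HB.instance Definition _ := NuAlg_isNormed.Build R (bfun R T)
  bfun_norm0_eq0 bfun_normD bfun_normZ bfun_normM.

End BfunNorm.

Section Families.
Context {K : pzRingType} {I : Type} (X : I -> nuAlgType K).

Definition family := forall i, X i.
Implicit Types x y z : family.

HB.instance Definition _ := gen_eqMixin family.
HB.instance Definition _ := gen_choiceMixin family.

Definition family_add x y : family := fun i => x i + y i.
Definition family_opp x : family := fun i => - x i.
Definition family_scale (a : K) x : family := fun i => a *: x i.
Definition family_mul x y : family := fun i => nmul (x i) (y i).

Fact family_addA : associative family_add.
Proof. by move=> x y z; apply/functional_extensionality_dep => i; exact: addrA. Qed.
Fact family_addC : commutative family_add.
Proof. by move=> x y; apply/functional_extensionality_dep => i; exact: addrC. Qed.
Fact family_add0 : left_id (fun i => 0 : X i) family_add.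
Proof. by move=> x; apply/functional_extensionality_dep => i; exact: add0r. Qed.
Fact family_addN : left_inverse (fun i => 0 : X i) family_opp family_add.
Proof. by move=> x; apply/functional_extensionality_dep => i; exact: addNr. Qed.

HB.instance Definition _ := GRing.isZmodule.Build family
  family_addA family_addC family_add0 family_addN.

Fact family_scalerA a b x :
  family_scale a (family_scale b x) = family_scale (a * b) x.
Proof. by apply/functional_extensionality_dep => i; exact: scalerA. Qed.
Fact family_scale1r : left_id 1 family_scale.
Proof. by move=> x; apply/functional_extensionality_dep => i; exact: scale1r. Qed.
Fact family_scalerDr : right_distributive family_scale +%R.
Proof. by move=> a x y; apply/functional_extensionality_dep => i; exact: scalerDr. Qed.
Fact family_scalerDl x : {morph family_scale^~ x : a b / a + b}.
Proof. by move=> a b; apply/functional_extensionality_dep => i; exact: scalerDl. Qed.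

HB.instance Definition _ := GRing.Zmodule_isLmodule.Build K family
  family_scalerA family_scale1r family_scalerDr family_scalerDl.

Fact family_mulA : associative family_mul.
Proof. by move=> x y z; apply/functional_extensionality_dep => i; exact: nmulA. Qed.
Fact family_mulDl : left_distributive family_mul +%R.
Proof. by move=> x y z; apply/functional_extensionality_dep => i; exact: nmulDl. Qed.
Fact family_mulDr : right_distributive family_mul +%R.
Proof. by move=> x y z; apply/functional_extensionality_dep => i; exact: nmulDr. Qed.
Fact family_scalerAl (a : K) x y : a *: family_mul x y = family_mul (a *: x) y.
Proof. by apply/functional_extensionality_dep => i; exact: nscalerAl. Qed.
Fact family_scalerAr (a : K) x y : a *: family_mul x y = family_mul x (a *: y).
Proof. by apply/functional_extensionality_dep => i; exact: nscalerAr. Qed.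

HB.instance Definition _ := Lmodule_isNuAlg.Build K family
  family_mulA family_mulDl family_mulDr family_scalerAl family_scalerAr.

Definition finitely_supported (x : family) := finite_set [set i | x i <> 0].

Lemma finitely_supported_is_subalg : is_subalg finitely_supported.
Proof.
have mul0 i (u : X i) : nmul 0 u = 0.
  by rewrite -(scale0r (0 : X i)) -nscalerAl !scale0r.
split.
- apply: (@sub_finite_set _ _ set0); last exact: finite_set0.
  by move=> i /= xi; exact: xi.
- move=> x y xF yF; apply: (@sub_finite_set _ _ ([set i | x i <> 0] `|`
    [set i | y i <> 0])); last by rewrite finite_setU.
  move=> i /= xyi; apply: contrapT => /not_orP[/contrapT x0 /contrapT y0].
  by apply: xyi; apply: etrans (addr0 0); congr (_ + _).
- move=> a x; apply: sub_finite_set => i /= axi x0; apply: axi.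
  by apply: etrans (scaler0 _ a); congr (_ *: _).
- move=> x y xF _; apply: sub_finite_set xF => i /= xyi x0; apply: xyi.
  by apply: etrans (mul0 _ (y i)); congr nmul.
Qed.

Definition dsum := subalg_type (Subalg finitely_supported_is_subalg).

HB.instance Definition _ := NuAlg.on dsum.

Definition dsum_fun (x : dsum) : forall i, X i := val x.

End Families.

Section NormedDirectSum.
Context {R : realType} {I : Type} (X : I -> normedNuAlgType R).

Lemma nnorm0 (A : normedNuAlgType R) : nnorm (0 : A) = 0 :> R.
Proof. by rewrite -(scale0r (0 : A)) nnormZ normc0 mul0r. Qed.

Lemma nnorm_ge0 (A : normedNuAlgType R) (x : A) : 0 <= nnorm x.
Proof.
have := ler_nnormD x (- 1 *: x); rewrite nnormZ normcN normc1 mul1r.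
by rewrite scaleN1r subrr nnorm0 -mulr2n pmulrn_lge0.
Qed.

Definition ndsum := dsum X.

HB.instance Definition _ := NuAlg.on ndsum.

Definition ndsum_norm (x : ndsum) : R := fsup (fun i => nnorm (dsum_fun x i)).

Fact ndsumB (x : ndsum) : has_ubound (range (fun i => nnorm (dsum_fun x i))).
Proof.
have xF : finite_set [set i | dsum_fun x i <> 0] := set_mem (valP x).
have [M MP] : has_ubound
    ((fun i => nnorm (dsum_fun x i)) @` [set i | dsum_fun x i <> 0]).
  have /finite_seqP[s ->] : finite_set
    ((fun i => nnorm (dsum_fun x i)) @` [set i | dsum_fun x i <> 0]).
    exact: finite_image.
  by exists (\big[Num.max/0]_(r <- s) r) => r /= rs; exact: le_bigmax_seq rs _.
exists (Num.max 0 M) => _ [i _ <-]; rewrite le_max.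
have [->|xi] := pselect (dsum_fun x i = 0); first by rewrite nnorm0 lexx.
by rewrite MP ?orbT//; exists i.
Qed.

Fact le_ndsum_norm (x : ndsum) i : nnorm (dsum_fun x i) <= ndsum_norm x.
Proof. by apply: (@le_fsup _ _ (fun i => nnorm _)); exact: ndsumB. Qed.

Fact ndsum_norm_ge0 (x : ndsum) : 0 <= ndsum_norm x.
Proof. by apply: fsup_ge0 => i; exact: nnorm_ge0. Qed.

Fact ndsum_norm0_eq0 (x : ndsum) : ndsum_norm x = 0 -> x = 0.
Proof.
move=> x0; apply/val_inj/functional_extensionality_dep => i.
apply: (@nnorm0_eq0 _ (X i)).
by apply/le_anti; rewrite nnorm_ge0 andbT -x0; exact: le_ndsum_norm.
Qed.
Fact ndsum_normD (x y : ndsum) : ndsum_norm (x + y) <= ndsum_norm x + ndsum_norm y.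
Proof.
apply: fsup_le => [|i]; first by rewrite addr_ge0// ndsum_norm_ge0.
exact: le_trans (ler_nnormD _ _) (lerD (le_ndsum_norm _ _) (le_ndsum_norm _ _)).
Qed.
Fact ndsum_normZ (a : R[i]) (x : ndsum) :
  ndsum_norm (a *: x) = normc a * ndsum_norm x.
Proof.
rewrite -(fsupZ _ (ndsumB x) (normc_ge0 a)) => [|i]; last exact: nnorm_ge0.
by congr fsup; apply/funext => i; rewrite -nnormZ.
Qed.
Fact ndsum_normM (x y : ndsum) :
  ndsum_norm (nmul x y) <= ndsum_norm x * ndsum_norm y.
Proof.
apply: fsup_le => [|i]; first by rewrite mulr_ge0// ndsum_norm_ge0.
apply: le_trans (ler_nnormM _ _) _.
by rewrite ler_pM ?nnorm_ge0 ?le_ndsum_norm.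
Qed.

HB.instance Definition _ := NuAlg_isNormed.Build R ndsum
  ndsum_norm0_eq0 ndsum_normD ndsum_normZ ndsum_normM.

End NormedDirectSum.

Section SequenceAlgebras.
Context (R : realType).

(* The term of index n : nat is the term number n.+1 of a sequence indexed by  *)
(* {1, 2, ...}, so it has weight harmonic n = 1 / n.+1.                        *)
Definition linfty : normedNuAlgType R := bfun R nat.

Definition harmonic_summable (A : set nat) :=
  cvgn (series (fun n => \1_A n * harmonic n : R)).

Definition supp (x : linfty) : set nat := [set n | (x : bfun R nat) n <> 0].

Definition s00_set : set linfty := [set x | harmonic_summable (supp x)].

Definition c00_set : set linfty := [set x | finite_set (supp x)].

Lemma supp0 : supp 0 = set0.
Proof. by apply/seteqP; split=> n. Qed.

Lemma suppD (x y : linfty) : supp (x + y) `<=` supp x `|` supp y.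
Proof.
move=> n /= xyn; apply: contrapT => /not_orP[/contrapT x0 /contrapT y0].
by apply: xyn; apply: etrans (bfunDE x y n) _; rewrite x0 y0 addr0.
Qed.

Lemma suppZ (a : R[i]) (x : linfty) : supp (a *: x) `<=` supp x.
Proof.
move=> n /= axn x0; apply: axn; apply: etrans (bfunZE a x n) _.
by rewrite x0 mulr0.
Qed.

Lemma suppM (x y : linfty) : supp (nmul x y) `<=` supp x `&` supp y.
Proof.
move=> n /= xyn; split=> [x0|y0]; apply: xyn.
  by apply: etrans (bfunME x y n) _; rewrite x0 mul0r.
by apply: etrans (bfunME x y n) _; rewrite y0 mulr0.
Qed.

Let term_ge0 (A : set nat) n : 0 <= \1_A n * harmonic n :> R.
Proof. by rewrite mulr_ge0// harmonic_ge0. Qed.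

Lemma harmonic_summable_sub (A B : set nat) :
  A `<=` B -> harmonic_summable B -> harmonic_summable A.
Proof.
move=> AB; apply: series_le_cvg => // n.
rewrite ler_wpM2r ?harmonic_ge0// !indicE ler_nat.
by case: (boolP (n \in A)) => // /set_mem/AB/mem_set ->.
Qed.

Lemma harmonic_summableU (A B : set nat) :
  harmonic_summable A -> harmonic_summable B -> harmonic_summable (A `|` B).
Proof.
move=> cA cB; have := is_cvg_seriesD cA cB.
apply: series_le_cvg => // n; first exact: addr_ge0.
apply: le_trans (_ : (\1_A n + \1_B n) * harmonic n <= _); last first.
  by rewrite mulrDl.
rewrite ler_wpM2r ?harmonic_ge0// !indicE in_setU -natrD ler_nat.
by case: (n \in A); case: (n \in B).
Qed.

Lemma harmonic_summable0 : harmonic_summable set0.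
Proof.
rewrite /harmonic_summable (_ : series _ = cst 0); first exact: is_cvg_cst.
by apply/funext => n; apply: big1 => i _; rewrite indicE in_set0 mul0r.
Qed.

Lemma s00_is_ideal : is_ideal s00_set.
Proof.
split; rewrite /s00_set /=.
- by rewrite supp0; exact: harmonic_summable0.
- move=> x y xs ys.
  exact: harmonic_summable_sub (@suppD x y) (harmonic_summableU xs ys).
- by move=> a x; apply: harmonic_summable_sub; exact: suppZ.
- by move=> x y ys; split; apply: harmonic_summable_sub ys => n /suppM[].
Qed.

Lemma c00_is_ideal : is_ideal c00_set.
Proof.
split; rewrite /c00_set /=.
- by rewrite supp0.
- move=> x y xs ys; apply: sub_finite_set (@suppD x y) _.
  by rewrite finite_setU.
- by move=> a x; apply: sub_finite_set; exact: suppZ.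
- by move=> x y ys; split; apply: sub_finite_set ys => n /suppM[].
Qed.

Definition c00 : ideal linfty := Ideal c00_is_ideal.

Definition s00_subalg : subalg linfty := subalg_of_ideal (Ideal s00_is_ideal).

Definition s00 : normedNuAlgType R := subalg_type s00_subalg.

Definition linfty_c00 : nuAlgType R[i] := quot_alg c00.

(* c00 is contained in s00, a finite sum being convergent.                     *)
Definition s00_c00 : nuAlgType R[i] := quot_alg (ideal_trace s00_subalg c00).

End SequenceAlgebras.

Arguments s00_set R : clear implicits.
Arguments c00_set R : clear implicits.

Section CompactlySupportedFunctions.
Context (R : realType) (Y : topologicalType).

Definition C00_set : set (bfun R Y) :=
  [set f | continuous (f : Y -> R[i]^o) /\
           compact (closure [set y | f y <> 0])].

Lemma C00_is_subalg : is_subalg C00_set.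
Proof.
have sub (f g : Y -> R[i]^o) : compact (closure [set y | f y <> 0]) ->
    [set y | g y <> 0] `<=` [set y | f y <> 0] ->
    compact (closure [set y | g y <> 0]).
  move=> fK gf; apply: subclosed_compact fK _; first exact: closed_closure.
  exact: closureS.
split.
- split; first exact: cst_continuous.
  rewrite (_ : [set y | _] = set0) ?closure0; last by apply/seteqP; split.
  exact: compact0.
- move=> f g [fc fK] [gc gK]; split.
    by move=> y; apply: continuousD; [exact: fc|exact: gc].
  apply: (@subclosed_compact _ _ (closure [set y | bfun_fun f y <> 0] `|`
      closure [set y | bfun_fun g y <> 0])); first exact: closed_closure.
    exact: compactU.
  rewrite -closureU; apply: closureS => y /= fgy.
  apply: contrapT => /not_orP[/contrapT f0 /contrapT g0].
  by apply: fgy; apply: etrans (bfunDE f g y) _; rewrite f0 g0 addr0.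
- move=> a f [fc fK]; split.
    have -> : bfun_fun (a *: f) = cst a \* bfun_fun f.
      by apply/funext => y; rewrite bfunZE.
    by move=> y; apply: (@continuousM R[i]); [exact: cst_continuous|exact: fc].
  apply: sub fK _ => y /= afy f0; apply: afy.
  by apply: etrans (bfunZE a f y) _; rewrite f0 mulr0.
- move=> f g [fc fK] [gc _]; split.
    have -> : bfun_fun (nmul f g) = bfun_fun f \* bfun_fun g.
      by apply/funext => y; rewrite bfunME.
    by move=> y; apply: (@continuousM R[i]); [exact: fc|exact: gc].
  apply: sub fK _ => y /= fgy f0; apply: fgy.
  by apply: etrans (bfunME f g y) _; rewrite f0 mul0r.
Qed.

Definition C00 : normedNuAlgType R := subalg_type (Subalg C00_is_subalg).

End CompactlySupportedFunctions.

Section StoneCech.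

Definition embedding (X B : topologicalType) (e : X -> B) :=
  injective e /\
  forall U : set X, open U <-> exists2 V : set B, open V & e @^-1` V = U.

(* (B, e) is the Stone-Cech compactification of X, which is determined up to   *)
(* homeomorphism; X is identified with its copy range e in B.                  *)
Definition is_stone_cech (X B : topologicalType) (e : X -> B) :=
  [/\ compact [set: B], hausdorff_space B, embedding e, dense (range e) &
      forall (K : topologicalType) (f : X -> K),
        compact [set: K] -> hausdorff_space K -> continuous f ->
        exists2 g : B -> K, continuous g & forall x, g (e x) = f x].

Context (R : realType) (B : topologicalType) (e : nat -> B).

Definition stone_cech_summable : set B :=
  \bigcup_(A in [set A | harmonic_summable R A]) closure (e @` A).

End StoneCech.

(* Main.v *)
From HB Require Import structures.
Require Import Defs.
From mathcomp Require Import all_boot all_order all_algebra finmap.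
From mathcomp Require Import all_classical all_reals all_analysis.
From mathcomp Require Import complex ring.

(* For (3), restricting f in C00(Y) to N is an isometric homomorphism, N     *)
(* being dense in Y. It lands in s00 because the sets cl A, with A summable, *)
(* form a directed open cover of Y, so the compact support of f lies in a    *)
(* single one. It is onto because x in s00 extends continuously to the       *)
(* compactification, where the extension vanishes off the compact set cl     *)
(* (supp x).                                                                 *)
(*                                                                           *)
(* For (4) and (5), the powers of 2 form a summable set, so any injection of *)
(* a countable set T into them embeds the bounded functions on T             *)
(* isometrically into s00. Taking T = N * N gives (4). For (5), the branches *)
(* of the binary tree give continuum many pairwise almost disjoint subsets   *)
(* of the powers of 2, hence as many copies of l_infty / c00 in s00 / c00    *)
(* that annihilate each other; multiplying a sum of their elements by the    *)
(* unit of one copy recovers the corresponding component, so their sum is    *)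
(* direct.                                                                   *)

Set Implicit Arguments.
Unset Strict Implicit.
Unset Printing Implicit Defensive.

Import Order.TTheory GRing.Theory Num.Theory.
Import numFieldNormedType.Exports.
Import Normc.

Local Open Scope classical_set_scope.
Local Open Scope ring_scope.

(** The summable sets of indices are closed under subsets and finite unions, which makes the
    sequences supported on them an ideal. Singletons are summable, but the set of all indices is not
    ([harmonic_summableT]). This gap gives two of the claims: a unit would be non-zero at every
    index, and if Y were compact it would lie in the closure of a single summable set, which would
    then contain every index.

    The topology in (3) rests on [closure_image_clopen]: closures of sets of integers are clopen in
    the compactification and contain no further integers. [compact_sub_clo] turns this into
    summability of the supports of restrictions, and [complex_extension] inverts restriction. The
    embeddings in (4) and (5) are built from [push]; (5) combines [branch_almost_disjoint] with the
    direct-sum criterion [orthogonal_sum_inj]. *)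

(** * Copies of algebras as ranges of injective homomorphisms, and maps between quotients *)

Section NonUnitalAlgebras.
Context {K : pzRingType}.
Implicit Types A B C : nuAlgType K.

Lemma nmul0r A (x : A) : nmul 0 x = 0.
Proof. by rewrite -(scale0r (0 : A)) -nscalerAl !scale0r. Qed.

Lemma nmulr0 A (x : A) : nmul x 0 = 0.
Proof. by rewrite -(scale0r (0 : A)) -nscalerAr !scale0r. Qed.

Lemma nmul_suml A (J : Type) (r : seq J) (F : J -> A) (y : A) :
  nmul (\sum_(j <- r) F j) y = \sum_(j <- r) nmul (F j) y.
Proof.
by apply: (big_morph (fun x => nmul x y)) => [u v|]; rewrite ?nmulDl ?nmul0r.
Qed.

Lemma nmul_sumr A (J : Type) (r : seq J) (F : J -> A) (y : A) :
  nmul y (\sum_(j <- r) F j) = \sum_(j <- r) nmul y (F j).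
Proof.
by apply: (big_morph (nmul y)) => [u v|]; rewrite ?nmulDr ?nmulr0.
Qed.

Lemma alg_isomorphicI A B (f : A -> B) :
  linear f -> bijective f -> {morph f : x y / nmul x y} ->
  alg_isomorphic A B.
Proof.
move=> fL fb fM.
pose g : {linear A -> B} := HB.pack f (GRing.isLinear.Build K A B *:%R f fL).
by exists g.
Qed.

Section Range.
Context {A B : nuAlgType K} (f : A -> B).
Hypotheses (fL : linear f) (fM : {morph f : x y / nmul x y}).

Let g : {linear A -> B} := HB.pack f (GRing.isLinear.Build K A B *:%R f fL).

Lemma range_is_subalg : is_subalg (range f).
Proof.
split.
- by exists 0 => //; exact: (linear0 g).
- by move=> _ _ [x _ <-] [y _ <-]; exists (x + y) => //; exact: (linearD g).
- move=> a _ [x _ <-]; exists (a *: x) => //.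
  by rewrite -[f _]/(g _) linearZ.
- by move=> _ _ [x _ <-] [y _ <-]; exists (nmul x y).
Qed.

Definition range_subalg := Subalg range_is_subalg.

Definition corestrict (x : A) : subalg_type range_subalg :=
  exist _ (f x) (mem_set (imageT f x)).

Lemma corestrict_linear : linear corestrict.
Proof. by move=> a x y; apply: val_inj; exact: fL. Qed.

Lemma corestrictM : {morph corestrict : x y / nmul x y}.
Proof. by move=> x y; apply: val_inj; exact: fM. Qed.

Lemma corestrict_bij : injective f -> bijective corestrict.
Proof.
move=> fI.
have h y : {x | corestrict x = y}.
  apply: cid; have /set_mem[x _ fx] := valP y.
  by exists x; apply: val_inj.
exists (fun y => sval (h y)) => [x|y]; last exact: (svalP (h y)).
by have /(congr1 val)/fI := svalP (h (corestrict x)).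
Qed.

End Range.

Lemma contains_copyI A B (f : A -> B) :
  linear f -> injective f -> {morph f : x y / nmul x y} -> contains_copy B A.
Proof.
move=> fL fI fM; exists (range_subalg fL fM).
apply: (@alg_isomorphicI _ _ (corestrict fL fM)).
- exact: corestrict_linear.
- exact: corestrict_bij.
- exact: corestrictM.
Qed.

Lemma quot_class_eq0 A (I : ideal A) (x : A) :
  quot_class I x = 0 <-> ideal_set I x.
Proof.
(* The class of 0 is its own double, so cancellation identifies it with the zero of the quotient. *)
have <- : quot_class I 0 = 0.
  by apply: (@addrI _ (quot_class I 0)); rewrite -quot_classD !addr0.
by rewrite quot_classP subr0.
Qed.

Section QuotientLift.
Context {A B : nuAlgType K} (I : ideal A) (J : ideal B) (f : A -> B).
Hypotheses (fL : linear f) (fM : {morph f : x y / nmul x y}).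
Hypothesis fIJ : forall x, ideal_set J (f x) <-> ideal_set I x.

Let g : {linear A -> B} := HB.pack f (GRing.isLinear.Build K A B *:%R f fL).

(** The two directions of [fIJ] have separate uses: from I to J makes the value independent of the
    representative, from J to I makes the induced map injective. *)
Definition quot_lift (u : quot_alg I) : quot_alg J := quot_class J (f (repr u)).

Lemma quot_lift_class x : quot_lift (quot_class I x) = quot_class J (f x).
Proof.
apply/quot_classP; rewrite -[_ - _](linearB g); apply/fIJ/quot_classP.
exact: quot_class_repr.
Qed.

Lemma quot_lift_linear : linear quot_lift.
Proof.
move=> a; elim/(@quot_ind _ _ I) => x; elim/(@quot_ind _ _ I) => y.
rewrite [a *: _](esym (quot_classZ _ _ _)) -quot_classD !quot_lift_class fL.
by rewrite quot_classD quot_classZ.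
Qed.

Lemma quot_liftM : {morph quot_lift : u v / nmul u v}.
Proof.
elim/(@quot_ind _ _ I) => x; elim/(@quot_ind _ _ I) => y.
rewrite [nmul (quot_class _ _) _](esym (quot_classM _ _ _)) !quot_lift_class fM.
by rewrite quot_classM.
Qed.

Lemma quot_lift_inj : injective quot_lift.
Proof.
elim/(@quot_ind _ _ I) => x; elim/(@quot_ind _ _ I) => y.
rewrite !quot_lift_class => /quot_classP.
by rewrite -[_ - _](linearB g) => /fIJ/quot_classP.
Qed.

End QuotientLift.

End NonUnitalAlgebras.

(** * Isometric isomorphisms and isometric copies *)

Section NormedAlgebras.
Context {R : realType}.
Implicit Types A B : normedNuAlgType R.

Lemma alg_isometricI A B (f : A -> B) :
  linear f -> bijective f -> {morph f : x y / nmul x y} ->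
  (forall x, nnorm (f x) = nnorm x) -> alg_isometric A B.
Proof.
move=> fL fb fM fN.
pose g : {linear A -> B} := HB.pack f (GRing.isLinear.Build R[i] A B *:%R f fL).
by exists g.
Qed.

Lemma isometry_inj A B (f : A -> B) :
  linear f -> (forall x, nnorm (f x) = nnorm x) -> injective f.
Proof.
move=> fL fN x y fxy; apply/eqP; rewrite -subr_eq0; apply/eqP.
apply: nnorm0_eq0; rewrite -fN.
pose g : {linear A -> B} := HB.pack f (GRing.isLinear.Build R[i] A B *:%R f fL).
by rewrite -[f _]/(g _) linearB /= fxy subrr nnorm0.
Qed.

Lemma alg_isometric_sym A B : alg_isometric A B -> alg_isometric B A.
Proof.
move=> [f [[g fK gK] fM fN]]; apply: (@alg_isometricI _ _ g).
- by move=> a x y; apply: (can_inj fK); rewrite linearP !gK.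
- by exists f.
- by move=> x y; apply: (can_inj fK); rewrite fM !gK.
- by move=> x; rewrite -fN gK.
Qed.

Lemma contains_isometric_copyI A B (f : A -> B) :
  linear f -> {morph f : x y / nmul x y} ->
  (forall x, nnorm (f x) = nnorm x) -> contains_isometric_copy B A.
Proof.
move=> fL fM fN; exists (range_subalg fL fM).
apply: (@alg_isometricI _ _ (corestrict fL fM)).
- exact: corestrict_linear.
- exact/corestrict_bij/isometry_inj.
- exact: corestrictM.
- exact: fN.
Qed.

End NormedAlgebras.

(** * Summable and non-summable sets of indices *)

Section HarmonicSummable.
Context (R : realType).

Lemma harmonic_summableT : ~ harmonic_summable R setT.
Proof.
rewrite /harmonic_summable (_ : (fun _ => _) = harmonic).
  exact: dvg_harmonic.
by apply/funext => n; rewrite indicE in_setT mul1r.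
Qed.

(** The index [f j] has weight at most 1 / 2 ^ j, so every partial sum is bounded by the geometric
    series of ratio 1/2, whose value is the bound 2. *)
Lemma harmonic_summable_range (f : nat -> nat) :
  (forall j, (2 ^ j <= (f j).+1)%N) -> harmonic_summable R (range f).
Proof.
move=> f2; apply: nondecreasing_is_cvgn.
  by apply: nondecreasing_series => n _ _; rewrite mulr_ge0// harmonic_ge0.
exists 2 => _ [N _ <-]; rewrite /series /=.
(* The indicator of range f at n is at most the number of j with f j = n. *)
apply: (@le_trans _ _ (\sum_(0 <= n < N) \sum_(0 <= j < N)
    (f j == n)%:R * harmonic n)).
  apply: ler_sum_nat => n /andP[_ nN].
  rewrite -mulr_suml ler_wpM2r ?harmonic_ge0//.
  rewrite indicE; case: (boolP (n \in _)) => [/set_mem[j _ fjn]|_]; last first.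
    by rewrite sumr_ge0.
  (* Since j < 2 ^ j <= f j + 1, a preimage j of n satisfies j <= n, so cutting j off at N loses no
     preimage of an index below N. *)
  have jN : (j < N)%N.
    rewrite (leq_ltn_trans _ nN)// -fjn -ltnS.
    exact: leq_trans (ltn_expl j _) (f2 j).
  rewrite (big_rem j) /= ?mem_index_iota// fjn eqxx lerDl.
  by apply: sumr_ge0.
rewrite exchange_big_nat/=.
apply: (@le_trans _ _ (\sum_(0 <= j < N) geometric 1 (2^-1) j)).
  apply: ler_sum_nat => j _.
  apply: (@le_trans _ _ (harmonic (f j))).
    rewrite big_mkord; have [fN|Nf] := ltnP (f j) N.
      rewrite (bigD1 (Ordinal fN))//= eqxx mul1r big1 ?addr0// => i iN.
      rewrite (_ : f j == i = false) ?mul0r//; apply: contraNF iN => /eqP fi.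
      by apply/eqP/val_inj.
    rewrite big1 ?harmonic_ge0// => i _.
    by rewrite (gtn_eqF (leq_trans (ltn_ord i) Nf)) mul0r.
  rewrite /harmonic /geometric /= mul1r exprVn lef_pV2 ?posrE ?exprn_gt0//.
  by rewrite -natrX ler_nat f2.
apply: le_trans (geometric_le_lim N ler01 _ _) _ => //; rewrite ?invr_gt0//.
  by rewrite ger0_norm ?invr_ge0// invf_lt1// ltr1n.
by rewrite le_eqVlt; apply/orP; left; apply/eqP; field.
Qed.

Lemma harmonic_summable1 n : harmonic_summable R [set n].
Proof.
(* This fast-growing sequence takes the value n at j = 0. *)
apply: (@harmonic_summable_sub _ _ (range (fun j => (2 ^ j).-1 + n)%N)).
  by move=> _ ->; exists 0%N.
apply: harmonic_summable_range => j.
by rewrite -addSn prednK ?expn_gt0// leq_addr.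
Qed.

End HarmonicSummable.

(** * Extension by zero of bounded functions along an injection into the indices *)

Definition mk_bfun {R : realType} {T : Type} (u : T -> R[i]^o)
    (ub : bounded_function u) : bfun R T :=
  exist (fun v => v \in subalg_pred bounded_subalg) u (mem_set ub).

Lemma bounded_function1 {R : realType} {T : Type} :
  bounded_function (fun _ : T => 1 : R[i]^o).
Proof. by apply/bounded_functionP; exists (normc (1 : R[i])). Qed.

Lemma bfunP {R : realType} {T : Type} (a : R[i]) (x y : bfun R T) t :
  bfun_fun (a *: x + y) t = a * bfun_fun x t + bfun_fun y t.
Proof. by []. Qed.

Section Pushforward.
Context {R : realType} {T : Type} (f : T -> nat).
Hypothesis f_inj : injective f.

(** The preimage of n is picked independently of u, so the algebraic laws hold pointwise;
    injectivity of f enters only to evaluate at [f t]. *)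
Definition push_fun (u : T -> R[i]) (n : nat) : R[i] :=
  if pselect (exists t, f t = n) is left ex then u (projT1 (cid ex)) else 0.

Lemma push_funE u t : push_fun u (f t) = u t.
Proof.
rewrite /push_fun; case: pselect => [ex|[]]; last by exists t.
by case: cid => s /= /f_inj ->.
Qed.

Lemma push_fun_out u n : ~ range f n -> push_fun u n = 0.
Proof.
move=> fn; rewrite /push_fun; case: pselect => // ex; exfalso; apply: fn.
by case: ex => t ftn; exists t.
Qed.

Lemma push_funP (a : R[i]) u v n :
  push_fun (fun t => a * u t + v t) n = a * push_fun u n + push_fun v n.
Proof. by rewrite /push_fun; case: pselect => //; rewrite mulr0 addr0. Qed.

Lemma push_funM u v n :
  push_fun (fun t => u t * v t) n = push_fun u n * push_fun v n.
Proof. by rewrite /push_fun; case: pselect => //; rewrite mulr0. Qed.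

Lemma push_fun_case (P : nat -> Prop) :
  (forall t, P (f t)) -> (forall n, ~ range f n -> P n) -> forall n, P n.
Proof.
move=> Pf Pout n; have [[t _ <-]//|] := pselect (range f n); exact: Pout.
Qed.

Lemma push_fun_bounded (u : bfun R T) : bounded_function (push_fun u).
Proof.
apply/bounded_functionP; exists (bfun_norm u).
apply: push_fun_case => [t|n fn]; first by rewrite push_funE le_bfun_norm.
by rewrite push_fun_out// normc0 bfun_norm_ge0.
Qed.

Definition push_linfty (u : bfun R T) : linfty R :=
  mk_bfun (push_fun_bounded u).

Lemma supp_push u : supp (push_linfty u) = f @` [set t | u t <> 0].
Proof.
apply/seteqP; split; last first.
  by move=> _ [t ut <-]; rewrite /supp/= /bfun_fun/= push_funE.
apply: push_fun_case => [t|n fn]; rewrite /supp/= /bfun_fun/=.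
  by rewrite push_funE; exists t.
by rewrite push_fun_out.
Qed.

Hypothesis f_summable : harmonic_summable R (range f).

Lemma push_s00_subproof u : push_linfty u \in subalg_pred (s00_subalg R).
Proof.
apply/mem_set; apply: harmonic_summable_sub f_summable.
by rewrite supp_push => _ [t _ <-]; exists t.
Qed.

Definition push (u : bfun R T) : s00 R :=
  exist (fun x => x \in subalg_pred (s00_subalg R)) _ (push_s00_subproof u).

Lemma push_linear : linear push.
Proof.
move=> a u v; do 2 apply: val_inj; apply/funext => n.
exact: (push_funP a (bfun_fun u) (bfun_fun v)).
Qed.

Lemma pushM : {morph push : u v / nmul u v}.
Proof.
move=> u v; do 2 apply: val_inj; apply/funext => n.
exact: (push_funM (bfun_fun u) (bfun_fun v)).
Qed.

Lemma push_norm u : nnorm (push u) = nnorm u.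
Proof.
apply/le_anti/andP; split.
  apply: fsup_le; first exact: bfun_norm_ge0.
  apply: push_fun_case => [t|n fn]; rewrite /bfun_fun /=.
    by rewrite push_funE le_bfun_norm.
  by rewrite push_fun_out// normc0 bfun_norm_ge0.
apply: fsup_le => [|t]; first exact: bfun_norm_ge0.
by rewrite -push_funE; exact: (le_bfun_norm (push_linfty u)).
Qed.

End Pushforward.

(** The indicator of {n}, obtained by pushing the constant 1 from a one-point type, lies in the
    algebra. Multiplying it by a unit e shows that e does not vanish at n. Hence e has full support,
    against the divergence of the harmonic series. *)
Lemma s00_non_unital (R : realType) : ~ unital (s00 R).
Proof.
move=> [[e es] eP]; apply: (@harmonic_summableT R).
apply: harmonic_summable_sub (set_mem es) => n _ en0.
have n_inj : injective (fun _ : unit => n) by move=> [] [].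
have n_sum : harmonic_summable R (range (fun _ : unit => n)).
  apply: harmonic_summable_sub (@harmonic_summable1 R n).
  by move=> _ [_ _ <-].
have [] := eP (push n_inj n_sum (mk_bfun bounded_function1)).
move=> /(congr1 (fun x => bfun_fun (val x) n)) + _.
rewrite (bfunME e) en0 mul0r /bfun_fun /= => /esym.
rewrite (@push_funE R _ _ n_inj _ tt) => /eqP.
by rewrite oner_eq0.
Qed.

(* Position 2 ^ k - 1 is the term of index 2 ^ k, of weight 1 / 2 ^ k. *)
Lemma pickle_sparse_summable (R : realType) (T : countType) :
  harmonic_summable R (range (fun t : T => (2 ^ choice.pickle t).-1)).
Proof.
apply: (@harmonic_summable_sub _ _ (range (fun j => (2 ^ j).-1))).
  by move=> _ [t _ <-]; exists (choice.pickle t).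
by apply: harmonic_summable_range => j; rewrite prednK ?expn_gt0.
Qed.

Lemma pickle_sparse_inj (T : countType) :
  injective (fun t : T => (2 ^ choice.pickle t).-1).
Proof.
move=> s t /(congr1 succn); rewrite !prednK ?expn_gt0// => /eqP.
by rewrite eqn_exp2l// => /eqP /(pcan_inj choice.pickleK).
Qed.

Lemma dsum_funP {K : pzRingType} {I : Type} (X : I -> nuAlgType K) (a : K)
    (x y : dsum X) i :
  dsum_fun (a *: x + y) i = a *: dsum_fun x i + dsum_fun y i.
Proof. by []. Qed.

(** * A direct sum of function algebras inside the functions of two variables *)

Section Uncurry.
Context {R : realType} {I T : Type}.

Definition ndsum_eval (x : ndsum (fun _ : I => bfun R T : normedNuAlgType R))
  (p : I * T) : R[i]^o := bfun_fun (dsum_fun x p.1) p.2.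

Lemma ndsum_eval_bounded x : bounded_function (ndsum_eval x).
Proof.
apply/bounded_functionP; exists (ndsum_norm x) => p.
exact: le_trans (le_bfun_norm (dsum_fun x p.1) p.2) (le_ndsum_norm x p.1).
Qed.

Definition ndsum_uncurry (x : ndsum _) : bfun R (I * T) :=
  mk_bfun (ndsum_eval_bounded x).

Lemma ndsum_uncurry_linear : linear ndsum_uncurry.
Proof.
move=> a x y; apply: val_inj; apply/funext => p.
by rewrite /= /ndsum_eval dsum_funP bfunP.
Qed.

Lemma ndsum_uncurryM : {morph ndsum_uncurry : x y / nmul x y}.
Proof. by move=> x y; apply: val_inj; apply/funext => p. Qed.

(** An iterated supremum is the supremum over pairs. *)
Lemma ndsum_uncurry_norm x : nnorm (ndsum_uncurry x) = nnorm x.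
Proof.
apply/le_anti/andP; split.
  apply: fsup_le => [|p]; first exact: ndsum_norm_ge0.
  exact: le_trans (le_bfun_norm (dsum_fun x p.1) p.2) (le_ndsum_norm x p.1).
apply: fsup_le => [|i]; first exact: bfun_norm_ge0.
apply: fsup_le => [|t]; first exact: bfun_norm_ge0.
exact: (le_bfun_norm (ndsum_uncurry x) (i, t)).
Qed.

End Uncurry.

Lemma s00_contains_ndsum (R : realType) :
  contains_isometric_copy (s00 R) (ndsum (fun _ : nat => linfty R)).
Proof.
pose p := push (@pickle_sparse_inj (nat * nat)%type)
  (@pickle_sparse_summable R (nat * nat)%type).
apply: (@contains_isometric_copyI _ _ _ (p \o ndsum_uncurry)) => [a x y|x y|x].
- by rewrite /= ndsum_uncurry_linear; exact: push_linear.
- by rewrite /= ndsum_uncurryM; exact: pushM.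
- by rewrite -[RHS]ndsum_uncurry_norm; exact: push_norm.
Qed.

(** * Homomorphisms with mutually annihilating ranges combine on the direct sum *)

Section OrthogonalSum.
Context {K : pzRingType} {I : choiceType}.
Context (X : I -> nuAlgType K) (B : nuAlgType K).
Variable h : forall i, X i -> B.
Arguments h : clear implicits.
Hypotheses (hL : forall i, linear (h i))
  (hM : forall i, {morph h i : x y / nmul x y})
  (hI : forall i, injective (h i))
  (h_orth : forall i j x y, i <> j -> nmul (h i x) (h j y) = 0).

Let h0 i : h i 0 = 0.
Proof.
pose g : {linear X i -> B} := HB.pack (h i)
  (GRing.isLinear.Build K (X i) B *:%R (h i) (@hL i)).
exact: (linear0 g).
Qed.

Let D (x : dsum X) := [set i | dsum_fun x i <> 0].

Let D_finite x : finite_set (D x).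
Proof. exact: set_mem (valP x). Qed.

Definition orthogonal_sum (x : dsum X) : B :=
  \sum_(i \in D x) h i (dsum_fun x i).

(** Elements with different supports can be compared over one common index set, the added terms
    being [h i 0], that is, 0. *)
Lemma orthogonal_sumE (E : set I) x : finite_set E -> D x `<=` E ->
  orthogonal_sum x = \sum_(i <- fset_set E) h i (dsum_fun x i).
Proof.
move=> Efin DE; rewrite -fsbig_finite//; apply: fsbig_widen => // i [_].
by move=> /contrapT /= ->.
Qed.

Lemma orthogonal_sum_linear : linear orthogonal_sum.
Proof.
move=> a x y; pose E := D x `|` D y.
have Efin : finite_set E by rewrite finite_setU.
rewrite !(@orthogonal_sumE E)//; first last.
- move=> i xyi; apply: contrapT => /not_orP[/contrapT x0 /contrapT y0].
  by apply: xyi; rewrite dsum_funP x0 y0 scaler0 addr0.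
- exact: subsetUl.
- exact: subsetUr.
rewrite scaler_sumr -big_split /=; apply: eq_bigr => i _.
by rewrite dsum_funP hL.
Qed.

(** Orthogonality kills every term but the j-th, so multiplying by the range of [h j] isolates
    component j. Both multiplicativity and, with units, injectivity follow from this. *)
Lemma orthogonal_sumMl x j y :
  nmul (orthogonal_sum x) (h j y) = h j (nmul (dsum_fun x j) y).
Proof.
(* The index j is adjoined because it may lie outside the support of x. *)
pose E := D x `|` [set j].
have Efin : finite_set E by rewrite finite_setU.
rewrite (@orthogonal_sumE E)//; last exact: subsetUl.
rewrite nmul_suml (bigD1_seq j)/= ?in_fset_set ?fset_uniq//; last first.
  by apply/mem_set; right.
rewrite big1 ?addr0 ?hM// => i /eqP ij; exact: h_orth.
Qed.

Lemma orthogonal_sumM : {morph orthogonal_sum : x y / nmul x y}.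
Proof.
move=> x y; rewrite (@orthogonal_sumE (D y) y)// nmul_sumr.
rewrite (@orthogonal_sumE (D y))//; last first.
  move=> i /= xyi y0; apply: xyi.
  by apply: etrans (nmulr0 (dsum_fun x i)); congr nmul.
by apply: eq_bigr => i _; rewrite orthogonal_sumMl.
Qed.

Lemma orthogonal_sum_inj : (forall i, unital (X i)) -> injective orthogonal_sum.
Proof.
move=> X1 x y xy; apply/val_inj/functional_extensionality_dep => i.
have [e eP] := X1 i.
have := congr1 (nmul^~ (h i e)) xy.
by rewrite !orthogonal_sumMl => /hI; rewrite !(eP _).2.
Qed.

End OrthogonalSum.

(** * Continuum many almost disjoint summable sets *)

Section Branches.
Implicit Types b : nat -> bool.

(** The prefix of length n is the node of depth n on the branch b of the binary tree; nodes are sent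
    injectively to positions of powers of 2. *)
Definition branch b n := (2 ^ choice.pickle (mkseq b n)).-1.

Lemma branch_inj b : injective (branch b).
Proof. by move=> m n /pickle_sparse_inj/(congr1 size); rewrite !size_mkseq. Qed.

Lemma branch_summable (R : realType) b : harmonic_summable R (range (branch b)).
Proof.
apply: harmonic_summable_sub (@pickle_sparse_summable R (seq bool)).
by move=> _ [n _ <-]; exists (mkseq b n).
Qed.

(** A common node has the same depth on both branches, its depth being its length as a prefix. If b
    and c differ at d, prefixes longer than d differ, so common nodes have depth at most d. *)
Lemma branch_almost_disjoint b c : b <> c ->
  finite_set (range (branch b) `&` range (branch c)).
Proof.
move=> bc; have [d bcd] : exists d, b d <> c d.
  by apply: contra_notP bc => /forallNP bc; apply/funext => d; apply: contrapT.
apply: (@sub_finite_set _ _ (branch b @` `I_d.+1)); last first.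
  exact/finite_image/finite_II.
move=> _ [[m _ <-] [n _ /esym mn]]; exists m => //=; rewrite ltnS leqNgt.
apply/negP => dm; apply: bcd; have {mn} := pickle_sparse_inj mn.
move=> /[dup] /(congr1 size); rewrite !size_mkseq => <-.
by move=> /(congr1 (nth false ^~ d)); rewrite !nth_mkseq.
Qed.

End Branches.

(** * The branches give orthogonal copies of the quotient of bounded sequences *)

Section BranchSum.
Context {R : realType}.

Lemma linfty_c00_unital : unital (linfty_c00 R).
Proof.
exists (quot_class _ (mk_bfun bounded_function1)).
elim/(@quot_ind _ _ (c00 R)) => x.
by split; rewrite [LHS](esym (quot_classM _ _ _)); congr quot_class;
  apply: val_inj; apply/funext => n; [apply: mul1r|apply: mulr1].
Qed.

Definition branch_push (b : nat -> bool) : linfty R -> s00 R :=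
  push (@branch_inj b) (@branch_summable R b).

(** Supports are carried along an injection, so finiteness passes both ways; this is what
    [quot_lift] requires. *)
Lemma branch_push_c00 b x :
  ideal_set (ideal_trace (s00_subalg R) (c00 R)) (branch_push b x)
  <-> ideal_set (c00 R) x.
Proof.
rewrite /= /c00_set /= supp_push; split; last exact: finite_image.
move=> /(finite_preimage (in2W (@branch_inj b))); apply: sub_finite_set.
by move=> n xn; exists n.
Qed.

Definition branch_hom b : linfty_c00 R -> s00_c00 R :=
  @quot_lift _ _ _ (c00 R) (ideal_trace (s00_subalg R) (c00 R)) (branch_push b).

Lemma branch_hom_linear b : linear (branch_hom b).
Proof. exact: (quot_lift_linear (push_linear _ _) (branch_push_c00 b)). Qed.

Lemma branch_homM b : {morph branch_hom b : x y / nmul x y}.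
Proof.
exact: (quot_liftM (push_linear _ _) (pushM _ _) (branch_push_c00 b)).
Qed.

Lemma branch_hom_inj b : injective (branch_hom b).
Proof. exact: (quot_lift_inj (push_linear _ _) (branch_push_c00 b)). Qed.

(** The product of representatives is supported on the intersection of two branches, which is
    finite, so it vanishes modulo [c00]. *)
Lemma branch_hom_orth b c x y : b <> c ->
  nmul (branch_hom b x) (branch_hom c y) = 0.
Proof.
move=> bc; rewrite [LHS](esym (quot_classM _ _ _)).
apply/quot_class_eq0; rewrite /= /c00_set /=.
apply: sub_finite_set (branch_almost_disjoint bc) => n.
move=> /suppM; rewrite !supp_push => -[[k _ <-] [l _ kl]].
by split; [exists k|exists l].
Qed.

Lemma s00_c00_contains_dsum (I : Type) :
  ([set: I] #= [set: nat -> bool])%card ->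
  contains_copy (s00_c00 R) (dsum (fun _ : I => linfty_c00 R)).
Proof.
move=> /card_set_bijP[b [_ b_inj _]].
(* Summing over finite sets of indices requires a choice structure, which I receives classically. *)
pose J : choiceType := HB.pack I (gen_eqMixin I) (gen_choiceMixin I).
pose h (i : J) := branch_hom (b i).
have hL i : linear (h i) by exact: branch_hom_linear.
have hM i : {morph h i : x y / nmul x y} by exact: branch_homM.
have hI i : injective (h i) by exact: branch_hom_inj.
have hO i j x y : i <> j -> nmul (h i x) (h j y) = 0.
  move=> ij; apply: branch_hom_orth => /b_inj.
  by rewrite !in_setT => /(_ isT isT).
apply: (@contains_copyI _ (dsum (fun _ : J => linfty_c00 R)) _
  (orthogonal_sum h)).
- exact: orthogonal_sum_linear.
- by apply: orthogonal_sum_inj => // i; exact: linfty_c00_unital.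
- exact: orthogonal_sumM.
Qed.

End BranchSum.

(** * Topology of subspaces and of the complex numbers *)

Lemma continuous_discrete (X : discreteTopologicalType) (T : topologicalType)
  (f : X -> T) : continuous f.
Proof. by apply/continuousP => A _; exact: discrete_open. Qed.

Section SubtypeTopology.
Context {X : topologicalType} (Y : set X).

Lemma continuous_set_val : continuous (set_val : Y -> X).
Proof. exact: initial_continuous. Qed.

Lemma hausdorff_set_type : hausdorff_space X -> hausdorff_space Y.
Proof.
move=> hX p q pq; apply/val_inj/hX => U V Up Vq.
have [y [Uy Vy]] := pq _ _ (continuous_set_val Up) (continuous_set_val Vq).
by exists (set_val y).
Qed.

(** A filter on the subspace is pushed forward to X and clusters at a point of K; as open sets of Y
    are traces of open sets of X, this point is also a cluster point in Y. *)
Lemma compact_set_type (K : set X) : K `<=` Y -> compact K ->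
  compact (set_val @^-1` K : set Y).
Proof.
move=> KY Kc F FF FK.
have [x [Kx xF]] := Kc (set_val @ F) _ FK.
exists (exist _ x (mem_set (KY _ Kx))); split => // U V FU.
rewrite nbhsE => -[W [[W' oW' <-] W'x] WV].
have FU' : F (set_val @^-1` (set_val @` U)).
  by apply: filterS FU => y Uy; exists y.
have [_ [[y Uy <-] W'y]] := xF _ _ FU' (open_nbhs_nbhs (conj oW' W'x)).
by exists y; split => //; exact: WV.
Qed.

End SubtypeTopology.

Section ComplexTopology.
Context {R : realType}.

Lemma continuous_normc : continuous (fun z : R[i]^o => normc z).
Proof.
move=> z U /nbhs_ballP[r /= r0 rU].
have r0C : 0 < r%:C%C :> R[i] by rewrite ltcR.
apply: filterS (nbhsx_ballx z _ r0C) => w zw; apply: rU; move: zw.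
(* The norm of [R[i]] takes values in [R[i]]; once the comparison is brought back to R, the reverse
   triangle inequality concludes. *)
rewrite -!ball_normE /= -[ `|z - w| ]/((normc (z - w))%:C)%C ltcR.
apply: le_lt_trans; rewrite ler_norml; apply/andP; split.
  rewrite lerNl opprB lerBlDr -[normc (z - w)]normcN opprB.
  by rewrite -{1}[w](subrK z) le_normcD.
by rewrite lerBlDr -{1}[z](subrK w) le_normcD.
Qed.

Lemma continuous_real_complex : continuous (fun r : R => r%:C%C : R[i]^o).
Proof.
move=> r; apply/cvgrPdist_lt => -[d d'] d0.
(* A radius that is positive in [R[i]] has zero imaginary part. *)
move: d0; rewrite ltcE /= => /andP[/eqP -> d0].
have : nbhs r (ball r d) by exact: nbhsx_ballx.
apply: filterS => s; rewrite -ball_normE /= => rs.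
rewrite -rmorphB normc_def /= expr0n/= addr0 sqrtr_sqr.
by rewrite -[X in _ < X]/(d%:C%C) ltcR.
Qed.

End ComplexTopology.

(** * Clopen closures and extension of bounded sequences to the compactification *)

Section StoneCechOfN.
Context {R : realType} {B : topologicalType} {e : nat -> B}.
Hypothesis eB : is_stone_cech e.

Let e_dense : dense (range e). Proof. by case: eB. Qed.

(** By density, every neighbourhood of b meets V in a point of [range e], and such a point comes
    from A. *)
Lemma closure_image_open (A : set nat) (V : set B) b :
  open V -> V b -> (forall n, V (e n) -> A n) -> closure (e @` A) b.
Proof.
move=> oV Vb VA W; rewrite nbhsE => -[W' [oW' W'b] WW].
have [x [[W'x Vx] [n _ nx]]] : (W' `&` V) `&` range e !=set0.
  by apply: e_dense; [exists b|exact: openI].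
rewrite -nx in W'x Vx.
by exists (e n); split; [exists n => //; exact: VA|exact: WW].
Qed.

(* The closure of A is the preimage of true under the extension of the    *)
(* indicator function of A.                                               *)
Lemma closure_image_clopen (A : set nat) :
  open (closure (e @` A)) /\ forall n, closure (e @` A) (e n) -> A n.
Proof.
have [_ _ _ _ ext] := eB.
have [g gc ge] := ext bool (fun n => n \in A) bool_compact discrete_hausdorff
  (@continuous_discrete _ _ _).
have -> : closure (e @` A) = g @^-1` [set true].
  apply/seteqP; split.
    rewrite (closure_id (g @^-1` [set true])).1.
      by apply: closureS => _ [n An <-] /=; rewrite ge; apply/mem_set.
    apply: closed_comp => [b _|]; first exact: gc.
    exact: discrete_closed.
  move=> b gb.
  apply: (@closure_image_open _ (g @^-1` [set true])) => // [|n /=].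
    by move/continuousP : gc; apply; exact: discrete_open.
  by rewrite ge => /set_mem.
split; first by move/continuousP : gc; apply; exact: discrete_open.
by move=> n /=; rewrite ge => /set_mem.
Qed.

(** The universal property needs a compact Hausdorff target, here the interval [-M, M] as a subtype;
    the extension therefore keeps the bound. *)
Lemma real_extension (u : nat -> R) M : (forall n, `|u n| <= M) ->
  exists g : B -> R, [/\ continuous g, forall n, g (e n) = u n &
    forall b, `|g b| <= M].
Proof.
move=> uM; have [_ _ _ _ ext] := eB.
pose K := `[- M, M]%classic : set R.
have uK n : u n \in K by apply/mem_set; rewrite /K /= in_itv /= -ler_norml.
have K_compact : compact [set: set_type K].
  rewrite (_ : setT = set_val @^-1` K); last first.
    by apply/seteqP; split=> // y _; exact: set_valP.
  by apply: compact_set_type => //; exact: segment_compact.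
have [g gc ge] := ext (set_type K) (fun n => exist _ (u n) (uK n)) K_compact
  (hausdorff_set_type (@Rhausdorff R)) (@continuous_discrete _ _ _).
exists (fun b => set_val (g b)); split=> [b|n|b]; last 2 first.
- by rewrite ge.
- by have := set_valP (g b); rewrite /K /= in_itv /= -ler_norml.
- exact: (continuous_comp (gc b) (@continuous_set_val _ K (g b))).
Qed.

(** The real and imaginary parts are bounded by the modulus; they are extended separately and
    recombined. *)
Lemma complex_extension (x : bfun R nat) :
  exists2 g : bfun R B, continuous (g : B -> R[i]^o) & forall n, g (e n) = x n.
Proof.
have re_le n : `|complex.Re (x n)| <= bfun_norm x.
  apply: le_trans (le_bfun_norm x n).
  by rewrite -lecR; exact: (normc_ge_Re (x n : R[i])).
have im_le n : `|complex.Im (x n)| <= bfun_norm x.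
  apply: le_trans (le_bfun_norm x n); case: (x n : R[i]) => a b /=.
  by rewrite -sqrtr_sqr ler_wsqrtr// lerDr sqr_ge0.
have [g [gc ge gM]] := real_extension re_le.
have [h [hc he hM]] := real_extension im_le.
pose k (b : B) : R[i]^o := (g b)%:C%C + 'i%C * (h b)%:C%C.
have k_bnd : bounded_function k.
  apply/bounded_functionP; exists (bfun_norm x + normc 'i%C * bfun_norm x) => b.
  apply: le_trans (le_normcD _ _) _; rewrite normcM.
  by rewrite lerD ?ler_wpM2l ?normc_ge0//= expr0n/= addr0 sqrtr_sqr.
exists (mk_bfun k_bnd) => [b|n]; last first.
  by rewrite /bfun_fun /= /k ge he -complexE.
apply: (@continuousD R[i] _ _ (fun b => (g b)%:C%C : R[i]^o)
  (fun b => 'i%C * (h b)%:C%C : R[i]^o)).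
  exact: (continuous_comp (gc b) (@continuous_real_complex R (g b))).
apply: (@continuousM R[i] _ (cst 'i%C)); first exact: cst_continuous.
exact: (continuous_comp (hc b) (@continuous_real_complex R (h b))).
Qed.

End StoneCechOfN.

(** * The subspace Y and its compactly supported functions *)

Section SummableSubspace.
Context {R : realType} {B : topologicalType} {e : nat -> B}.
Hypothesis eB : is_stone_cech e.
Local Notation Y := (stone_cech_summable R e).

Let e_dense : dense (range e). Proof. by case: eB. Qed.

(** These traces on Y are clopen for every A; for summable A they are moreover compact, and together
    they cover Y. *)
Let clo (A : set nat) : set Y := set_val @^-1` closure (e @` A).

Lemma range_sub_summable : range e `<=` Y.
Proof.
move=> _ [n _ <-]; exists [set n]; first exact: harmonic_summable1.
by apply: subset_closure; exists n.
Qed.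

Definition summable_point n : Y :=
  exist _ (e n) (mem_set (range_sub_summable (imageT e n))).

Lemma summable_point_dense (O : set Y) : O !=set0 -> open O ->
  exists n, O (summable_point n).
Proof.
move=> [y Oy] [W oW WO]; rewrite -WO in Oy.
have [b [Wb [n _ nb]]] := e_dense (ex_intro _ (set_val y) Oy : W !=set0) oW.
by exists n; rewrite -WO /= set_valE /= nb.
Qed.

Lemma range_dense : dense [set y : Y | range e (set_val y)].
Proof.
move=> O O0 /(summable_point_dense O0)[n On].
by exists (summable_point n); split => //; exists n.
Qed.

Let clo_open A : open (clo A).
Proof.
by exists (closure (e @` A)) => //; exact: (closure_image_clopen eB A).1.
Qed.

Let clo_closed A : closed (clo A).
Proof.
apply: closed_comp => [y _|]; first exact: continuous_set_val.
exact: closed_closure.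
Qed.

(** For summable A the whole closure lies in Y, so passing to the trace loses no point of a compact
    set. *)
Let clo_compact A : harmonic_summable R A -> compact (clo A).
Proof.
move=> As; apply: compact_set_type => [b Ab|]; first by exists A.
case: eB => Bc _ _ _ _; apply: subclosed_compact Bc _ => //.
exact: closed_closure.
Qed.

(** Near each point of Y, all points belong to [clo A] once A is large enough; compactness makes one
    A serve for all of K. *)
Let compact_sub_clo (K : set Y) : compact K ->
  exists2 A, harmonic_summable R A & K `<=` clo A.
Proof.
move=> /compact_near_coveringP Kc.
(* The filter of statements true of all large enough summable sets. *)
pose F : set_system (set nat) := [set S | exists2 A, harmonic_summable R A &
  forall A', harmonic_summable R A' -> A `<=` A' -> S A'].
have FF : Filter F.
  split.
  - by exists set0 => //; exact: harmonic_summable0.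
  - move=> S T [A As AS] [A' As' AT]; exists (A `|` A').
      exact: harmonic_summableU.
    move=> C Cs AC; split; [apply: AS|apply: AT] => //.
      by apply: subset_trans AC; exact: subsetUl.
    by apply: subset_trans AC; exact: subsetUr.
  - by move=> S T ST [A As AS]; exists A => // A' As' AA'; exact/ST/AS.
have [|A As] := Kc _ F clo FF; last first.
  by move=> /(_ A As (@subset_refl _ _)); exists A.
move=> y _; have /set_mem[A As yA] := valP y.
exists (clo A, [set A' | A `<=` A']) => /=.
  split; first exact: open_nbhs_nbhs.
  by exists A.
by move=> [z A'] /= [zA AA']; apply: closureS zA; exact: image_subset.
Qed.

Lemma summable_locally_compact : locally_compact [set: Y].
Proof.
move=> y _; have /set_mem[A As yA] := valP y.
exists (clo A); last by split; [exact: clo_compact|exact: clo_closed].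
by apply: filterS (open_nbhs_nbhs (conj (clo_open A) yA)) => z zA _.
Qed.

(** Otherwise Y lies in one [clo A] with A summable, and then A contains every index. *)
Lemma summable_not_compact : ~ compact [set: Y].
Proof.
move=> /compact_sub_clo[A As YA]; apply: (@harmonic_summableT R).
apply: harmonic_summable_sub As => n _.
exact/(closure_image_clopen eB A).2/(YA (summable_point n)).
Qed.

Lemma C00_at_points_bounded (f : C00 R (Y : Type)) :
  bounded_function (fun n => bfun_fun (val f) (summable_point n)).
Proof.
apply/bounded_functionP; exists (bfun_norm (val f)) => n.
exact: le_bfun_norm.
Qed.

Definition C00_restrict_linfty (f : C00 R (Y : Type)) : linfty R :=
  mk_bfun (C00_at_points_bounded f).

Lemma C00_restrict_s00 f : C00_restrict_linfty f \in subalg_pred (s00_subalg R).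
Proof.
apply/mem_set; have [_ /compact_sub_clo[A As fA]] := set_mem (valP f).
apply: harmonic_summable_sub As => n fn.
exact/(closure_image_clopen eB A).2/(fA (summable_point n))/subset_closure.
Qed.

Definition C00_restrict (f : C00 R (Y : Type)) : s00 R :=
  exist (fun x => x \in subalg_pred (s00_subalg R)) _ (C00_restrict_s00 f).

Lemma C00_restrict_linear : linear C00_restrict.
Proof.
move=> a f g; do 2 apply: val_inj; apply/funext => n.
by rewrite /= bfunP.
Qed.

Lemma C00_restrictM : {morph C00_restrict : f g / nmul f g}.
Proof. by move=> f g; do 2 apply: val_inj; apply/funext => n. Qed.

(** If |f| exceeded the norm of the restriction somewhere, it would do so on a non-empty open set,
    which by density contains a point of the sequence. *)
Lemma C00_restrict_norm f : nnorm (C00_restrict f) = nnorm f.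
Proof.
apply/le_anti/andP; split.
  apply: fsup_le => [|n]; first exact: bfun_norm_ge0.
  exact: (le_bfun_norm (val f) (summable_point n)).
apply: fsup_le => [|y]; first exact: bfun_norm_ge0.
rewrite leNgt; apply/negP => fy; have [fc _] := set_mem (valP f).
pose O := (fun y : Y => normc (bfun_fun (val f) y))
  @^-1` [set r | nnorm (C00_restrict f) < r].
have oO : open O.
  apply: open_comp; last exact: open_gt.
  move=> z _; exact: (continuous_comp (fc z) (@continuous_normc R _)).
have [n] := summable_point_dense (ex_intro _ y fy : O !=set0) oO.
by rewrite /O /= ltNge (le_bfun_norm (val (C00_restrict f)) n).
Qed.

Lemma C00_restrict_surj x : exists f, C00_restrict f = x.
Proof.
have [g gc ge] := complex_extension eB (val x).
have xs : harmonic_summable R (supp (val x)) := set_mem (valP x).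
have f_bnd : bounded_function (fun y : Y => g (set_val y)).
  by apply/bounded_functionP; exists (bfun_norm g) => y; exact: le_bfun_norm.
have fC00 : mk_bfun f_bnd \in subalg_pred (Subalg (@C00_is_subalg R Y)).
  apply/mem_set; split.
    by move=> y; exact: (continuous_comp (@continuous_set_val _ Y y) (gc _)).
  apply: subclosed_compact (clo_compact xs) _; first exact: closed_closure.
  (* The set where g is non-zero is open and meets [range e] only in the image of [supp (val x)], so
     it lies in the closure of that image. *)
  rewrite [clo _](closure_id _).1//; apply: closureS => y gy.
  apply: (@closure_image_open _ _ eB _ [set b | g b <> 0] _ _ gy) => [|n].
    have -> : [set b | g b <> 0] = (fun b => normc (g b)) @^-1` [set r | 0 < r].
      apply/seteqP; split=> b /=.
        move=> gb0; rewrite lt_def normc_ge0 andbT.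
        by apply/eqP => /eq0_normc.
      by move=> + gb0; rewrite gb0 normc0 ltxx.
    apply: open_comp; last exact: open_gt.
    by move=> b _; exact: (continuous_comp (gc b) (@continuous_normc R _)).
  by rewrite /= ge.
exists (exist (fun f => f \in subalg_pred _) _ fC00).
by do 2 apply: val_inj; apply/funext => n; exact: ge.
Qed.

Lemma s00_isometric_C00 : alg_isometric (s00 R) (C00 R (Y : Type)).
Proof.
apply/alg_isometric_sym/(@alg_isometricI _ _ _ C00_restrict).
- exact: C00_restrict_linear.
- have inj : injective C00_restrict.
    exact: isometry_inj C00_restrict_linear C00_restrict_norm.
  pose h x := cid (C00_restrict_surj x).
  exists (fun x => projT1 (h x)) => [f|x]; last exact: (projT2 (h x)).
  exact/inj/(projT2 (h (C00_restrict f))).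
- exact: C00_restrictM.
- exact: C00_restrict_norm.
Qed.

End SummableSubspace.

Theorem theorem3p1p1 (R : realType) :
  [/\ is_ideal (s00_set R),
      ~ unital (s00 R),
      (forall (B : topologicalType) (e : nat -> B), is_stone_cech e ->
        let Y := stone_cech_summable R e in
        [/\ alg_isometric (s00 R) (C00 R (Y : Type)),
            locally_compact [set: Y],
            ~ compact [set: Y],
            range e `<=` Y &
            dense [set y : Y | range e (set_val y)]]),
      contains_isometric_copy (s00 R) (ndsum (fun _ : nat => linfty R)) &
      forall I : Type, ([set: I] #= [set: nat -> bool])%card ->
        contains_copy (s00_c00 R) (dsum (fun _ : I => linfty_c00 R))].
Proof.
split.
- exact: s00_is_ideal.
- exact: s00_non_unital.
- move=> B e eB Y; split.
  + exact: s00_isometric_C00.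
  + exact: summable_locally_compact.
  + exact: summable_not_compact.
  + exact: range_sub_summable.
  + exact: range_dense.
- exact: s00_contains_ndsum.
- by move=> I; exact: s00_c00_contains_dsum.
Qed.
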